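(* Let $n$ be sufficiently large. Let time $t$ range over $[0,n]$ in discrete increments of size $dt$, and let $\{Z_t\}_{t\in[0,n]}$ be a random process in $\mathbb{R}^m$ with increments $dZ_t := Z_{t+dt} - Z_t$, such that $Z_0(i) \le 0$ for every $i \in [m]$, and such that, conditioned on the randomness up to time $t$, $dZ_t$ is $(\alpha,\theta)$-pairwise independent for fixed $\alpha \ge 1$, $\theta > 0$. Let $B \ge 1$, and call a coordinate $i$ bad at time $t$ if $Z_t(i) \ge B$. Suppose that (1) $\alpha, \theta, B$ and $m$ are all polynomially upper bounded in $n$; (2) $dt = 1/n^c$ where the constant $c$ can be chosen arbitrarily large; (3) $\|dZ_t\|_\infty = O(\sqrt{dt})$ for all time steps $t$, where the constant in $O(\cdot)$ may depend polynomially on $m, \alpha, \theta, B$. Then for any $\lambda > 0$ with $\lambda \le \theta/2$ and $\lambda B \le \log n$, with probability at least $1 - 1/\mathrm{poly}(n)$, the number of coordinates that ever become bad throughout the process is at most \[ \frac{m}{e^{\lambda B}} + O\Big(\frac{\lambda \alpha \log n}{\theta}\Big). \]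
   Context: Definition: for parameters $\alpha \ge 1$ and $\theta \ge 0$, a random vector $X \in \mathbb{R}^m$ is $(\alpha,\theta)$-pairwise independent if (i) for every $\gamma \in \mathbb{R}^m$, $\mathbb{E}[\langle \gamma, X\rangle^2] \le \alpha\, \mathbb{E}[\langle \gamma^2, X^2\rangle]$, where $\gamma^2, X^2$ denote the entrywise squares, i.e. $\langle \gamma^2, X^2\rangle = \sum_i \gamma(i)^2 X(i)^2$; and (ii) $\mathbb{E}[X(i)] \le -\theta\, \mathbb{E}[X(i)^2]$ for each $i \in [m]$. *)

(* Defs.v *)
From HB Require Import structures.
From mathcomp Require Import all_boot all_order all_algebra.
From mathcomp Require Import all_classical all_reals all_analysis.

Set Implicit Arguments.
Unset Strict Implicit.
Unset Printing Implicit Defensive.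

Import Order.TTheory GRing.Theory Num.Theory.
Import numFieldNormedType.Exports.

Local Open Scope classical_set_scope.
Local Open Scope ring_scope.

Definition sub_sigma_algebra {d : measure_display} {T : measurableType d}
    (G : set (set T)) : Prop :=
  sigma_algebra setT G /\ G `<=` measurable.

Definition filtration {d : measure_display} {T : measurableType d}
    (F : nat -> set (set T)) : Prop :=
  (forall k, sub_sigma_algebra (F k)) /\ (forall k, F k `<=` F k.+1).

Definition wrt_measurable {d : measure_display} {T : measurableType d}
    {R : realType} (G : set (set T)) (Y : T -> R) : Prop :=
  forall A : set R, measurable A -> G (Y @^-1` A).

(* [Y] is a version of the conditional expectation of [X] given [G]; versions
   are unique up to almost sure equality. *)
Definition is_cond_expectation {d : measure_display} {T : measurableType d}
    {R : realType} (P : probability T R) (G : set (set T)) (X Y : T -> R)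
    : Prop :=
  [/\ P.-integrable setT (EFin \o X),
      wrt_measurable G Y,
      P.-integrable setT (EFin \o Y)
    & forall A, G A -> (\int[P]_(x in A) (Y x)%:E = \int[P]_(x in A) (X x)%:E)%E].

(* E[X | G] <= a * E[X' | G] almost surely. *)
Definition cond_expectation_le {d : measure_display} {T : measurableType d}
    {R : realType} (P : probability T R) (G : set (set T)) (X : T -> R)
    (a : R) (X' : T -> R) : Prop :=
  exists Y Y' : T -> R,
    [/\ is_cond_expectation P G X Y, is_cond_expectation P G X' Y'
      & {ae P, forall x, Y x <= a * Y' x}].

(* (alpha, theta)-pairwise independence of [X] conditioned on [G]; for
   G = [set set0; setT] the conditional expectations are expectations and this
   is the unconditional notion. *)
Definition cond_pairwise_independent {d : measure_display}
    {T : measurableType d} {R : realType} (P : probability T R)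
    (G : set (set T)) (alpha theta : R) (m : nat) (X : T -> 'rV[R]_m) : Prop :=
  (forall gamma : 'rV[R]_m,
     cond_expectation_le P G
       (fun x => (\sum_(i < m) gamma ord0 i * X x ord0 i) ^+ 2)
       alpha
       (fun x => \sum_(i < m) gamma ord0 i ^+ 2 * X x ord0 i ^+ 2)) /\
  (forall i : 'I_m,
     cond_expectation_le P G
       (fun x => X x ord0 i)
       (- theta)
       (fun x => X x ord0 i ^+ 2)).

(* The process is indexed by step number: [Z k] is its value at time k * dt,
   and only the steps with k * dt <= n are relevant. *)
Definition ever_bad {T : Type} {R : realType} (n : nat) (dt B : R) (m : nat)
    (Z : nat -> T -> 'rV[R]_m) (x : T) : pred 'I_m :=
  [pred i | `[< exists k : nat, k%:R * dt <= n%:R /\ B <= Z k x ord0 i >]].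

(* Main.v *)
(* Freeze each coordinate when it first reaches B, and let Phi be the sum over
   the coordinates of exp(lambda Y(i)) for the frozen process Y. Condition (ii)
   gives Phi a negative drift proportional to the conditional second moments of
   the increments, and condition (i) bounds the conditional variance of the
   increment of Phi by alpha lambda e^(lambda B) times these same moments.
   Hence, for delta = theta / (8 alpha lambda e^(lambda B)), exp(delta Phi) is a
   supermartingale, and Markov's inequality gives
   Phi <= m + q ln n / delta outside an event of probability n^-q. Every bad
   coordinate contributes at least e^(lambda B) to the final value of Phi. *)

Require Import Defs.
From HB Require Import structures.
From mathcomp Require Import all_boot all_order all_algebra.
From mathcomp Require Import all_classical all_reals all_analysis.
From mathcomp Require Import measurable_realfun ring lra.

Set Implicit Arguments.
Unset Strict Implicit.
Unset Printing Implicit Defensive.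

Import Order.TTheory GRing.Theory Num.Theory.
Import numFieldNormedType.Exports.

Local Open Scope classical_set_scope.
Local Open Scope ring_scope.

(** * Bounded measurable functions and their integrals *)

Definition bounded_measurable {d : measure_display} {T : measurableType d}
    {R : realType} (f : T -> R) : Prop :=
  measurable_fun setT f /\ exists M : R, forall x, `|f x| <= M.

Section BoundedMeasurable.
Context {d : measure_display} {T : measurableType d} {R : realType}.
Implicit Types f g : T -> R.

Lemma bounded_measurable_cst (r : R) :
  bounded_measurable (fun _ : T => r).
Proof. by split; [exact: measurable_cst | exists `|r|]. Qed.

Lemma bounded_measurableD f g : bounded_measurable f ->
  bounded_measurable g -> bounded_measurable (fun x => f x + g x).
Proof.
move=> [mf [M fM]] [mg [N gN]]; split; first exact: measurable_funD.
exists (M + N) => x; apply: le_trans (ler_normD _ _) _.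
by apply: lerD.
Qed.

Lemma bounded_measurableM f g : bounded_measurable f ->
  bounded_measurable g -> bounded_measurable (fun x => f x * g x).
Proof.
move=> [mf [M fM]] [mg [N gN]]; split; first exact: measurable_funM.
by exists (M * N) => x; rewrite normrM ler_pM.
Qed.

Lemma bounded_measurableX f n : bounded_measurable f ->
  bounded_measurable (fun x => f x ^+ n).
Proof.
move=> [mf [M fM]]; split; first exact: measurable_funX.
by exists (M ^+ n) => x; rewrite normrX lerXn2r ?nnegrE// (le_trans _ (fM x)).
Qed.

Lemma bounded_measurableB f g : bounded_measurable f ->
  bounded_measurable g -> bounded_measurable (fun x => f x - g x).
Proof.
move=> mf mg; under eq_fun do rewrite -mulN1r.
by apply: bounded_measurableD => //; apply: bounded_measurableM => //;
  exact: bounded_measurable_cst.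
Qed.

Lemma bounded_measurable_sum (I : Type) (s : seq I) (F : I -> T -> R) :
  (forall i, bounded_measurable (F i)) ->
  bounded_measurable (fun x => \sum_(i <- s) F i x).
Proof.
move=> mF; elim: s => [|i s ih].
  by under eq_fun do rewrite big_nil; exact: bounded_measurable_cst.
by under eq_fun do rewrite big_cons; exact: bounded_measurableD.
Qed.

Lemma bounded_measurable_indic (A : set T) :
  measurable A -> bounded_measurable (\1_A : T -> R).
Proof.
move=> mA; split; first exact: measurable_indic.
by exists 1 => x; rewrite indicE; case: (x \in A); rewrite ?normr1 ?normr0.
Qed.

Lemma bounded_measurable_integrable (P : probability T R) (A : set T) f :
  measurable A -> bounded_measurable f -> P.-integrable A (EFin \o f).
Proof.
move=> mA [mf [M fM]]; apply: measurable_bounded_integrable => //.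
- by apply: le_lt_trans (probability_le1 P mA) _; rewrite ltry.
- exact: measurable_funS mf.
- by exists M; split; [exact: num_real | move=> N MN x _; exact: le_trans (fM x) (ltW MN)].
Qed.

Lemma Rintegral_sum (P : probability T R) (A : set T) (I : Type) (s : seq I)
    (F : I -> T -> R) : measurable A -> (forall i, bounded_measurable (F i)) ->
  \int[P]_(x in A) (\sum_(i <- s) F i x) = \sum_(i <- s) \int[P]_(x in A) F i x.
Proof.
move=> mA mF; elim: s => [|i s ih].
  under eq_Rintegral do rewrite big_nil.
  by rewrite Rintegral_cst// mul0r big_nil.
under eq_Rintegral do rewrite big_cons.
rewrite RintegralD ?big_cons ?ih//; apply: bounded_measurable_integrable => //.
exact: bounded_measurable_sum.
Qed.

Lemma Rintegral_indicM (P : probability T R) (A : set T) f :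
  \int[P]_x (\1_A x * f x) = \int[P]_(x in A) f x.
Proof.
rewrite [RHS]Rintegral_mkcond; apply: eq_Rintegral => x _.
by rewrite patchE indicE; case: (x \in A); rewrite ?mul1r ?mul0r.
Qed.

Lemma markov_bounded_measurable (P : probability T R) f (K : R) :
  0 < K -> (forall x, 0 <= f x) -> bounded_measurable f ->
  (P [set x | (K <= f x)%R] <= ((\int[P]_x f x) / K)%:E)%E.
Proof.
move=> K0 f0 mf; set A := [set x | K <= f x].
have mA : measurable A.
  rewrite (_ : A = f @^-1` `[K, +oo[).
    by rewrite -[X in measurable X]setTI; apply: mf.1 => //; exact: measurable_itv.
  by apply/seteqP; split=> x; rewrite /A /= in_itv/= andbT.
have mI : bounded_measurable (\1_A : T -> R) by exact: bounded_measurable_indic.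
have mK := bounded_measurable_cst K.
rewrite -(fineK (fin_num_measure P A mA)) lee_fin ler_pdivlMr// mulrC.
have -> : fine (P A) = \int[P]_x \1_A x.
  by rewrite /Rintegral integral_indic// setIT.
rewrite -RintegralZl//; last exact: bounded_measurable_integrable.
apply: le_Rintegral => //.
- by apply: bounded_measurable_integrable => //; exact: bounded_measurableM.
- exact: bounded_measurable_integrable.
move=> x _; rewrite indicE; case: (boolP (x \in A)) => [|_].
  by rewrite inE /A/= mulr1.
by rewrite mulr0.
Qed.

End BoundedMeasurable.

(** * Measurability with respect to a sub-sigma-algebra *)

Section SubSigmaAlgebra.
Context {d : measure_display} {T : measurableType d} {R : realType}.
Variables (G : set (set T)) (sG : Defs.sub_sigma_algebra G).

(** Turns [G] into a measurable structure of its own, so that the closure properties of measurable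
    functions become available for [wrt_measurable]. *)
Lemma wrt_measurableE (f : T -> R) :
  wrt_measurable G f <->
  measurable_fun (setT : set (g_sigma_algebraType G)) f.
Proof.
have GE : <<s G >> = G by apply: sigma_algebra_id; case: sG.
split=> [mf _ A mA|mf A mA].
  by rewrite setTI /measurable/= GE; exact: mf.
by have := mf measurableT A mA; rewrite setTI /measurable/= GE.
Qed.

Lemma wrt_measurable_fun (f : T -> R) :
  wrt_measurable G f -> measurable_fun setT f.
Proof. by move=> mf _ A mA; rewrite setTI; case: sG => _; apply; exact: mf. Qed.

(** These half-open boxes serve as the cells of the grid on which random coefficients are
    rounded. *)
Lemma wrt_measurable_cell (I : finType) (U : I -> T -> R) (lo hi : I -> R) :
  (forall i, wrt_measurable G (U i)) ->
  G [set x | forall i, lo i <= U i x < hi i].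
Proof.
move=> mU; have GE : <<s G >> = G by apply: sigma_algebra_id; case: sG.
have -> : [set x | forall i, lo i <= U i x < hi i] =
    \bigcap_(i in [set: I]) (U i @^-1` `[lo i, hi i[).
  apply/seteqP; split=> [x h i _|x h i] /=; first by rewrite in_itv/= h.
  by have := h i Logic.I; rewrite /= in_itv.
rewrite -GE; apply: (@fin_bigcap_measurable _ (g_sigma_algebraType G)).
  exact: finite_finset.
by move=> i _; rewrite /measurable/= GE; apply: mU; exact: measurable_itv.
Qed.

End SubSigmaAlgebra.

(** * From constant coefficients to [G]-measurable coefficients *)

Section RandomCoefficients.
Context {d : measure_display} {T : measurableType d} {R : realType}.
Variables (P : probability T R) (G : set (set T)).
Hypothesis sG : Defs.sub_sigma_algebra G.

(* Round the coefficients down to the grid of mesh [1/(r+1)]: the events on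
   which the rounded coefficients take given values belong to [G], so the
   hypothesis for constant coefficients applies on each of them. *)
Lemma random_coefficient_le0 (I : finType) (h : (I -> R) -> T -> R)
    (U : I -> T -> R) (D L : R) :
  (forall c, (forall i, 0 <= c i) -> bounded_measurable (h c)) ->
  (forall c A, (forall i, 0 <= c i) -> G A -> \int[P]_(x in A) h c x <= 0) ->
  (forall u v e x, (forall i, 0 <= u i <= D) -> (forall i, 0 <= v i <= D) ->
     (forall i, `|u i - v i| <= e) -> `|h u x - h v x| <= L * e) ->
  (forall i, wrt_measurable G (U i)) ->
  (forall i x, 0 <= U i x <= D) ->
  bounded_measurable (fun x => h (U ^~ x) x) ->
  \int[P]_x h (U ^~ x) x <= 0.
Proof.
move=> mh h_le0 hL mU UD mhU.
(* Rounding costs at most [L] times the mesh, and the mesh is arbitrary. *)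
have bound (r : nat) : \int[P]_x h (U ^~ x) x <= L / r.+1%:R.
  have r0 : 0 < r.+1%:R :> R by rewrite ltr0n.
  (* Every value in [[0, D]] rounds down to an index below [N], so finitely many cells suffice. *)
  pose N := (Num.trunc (D * r.+1%:R)).+1.
  pose c (f : {ffun I -> 'I_N}) (i : I) : R := (f i)%:R / r.+1%:R.
  pose A f := [set x | forall i, c f i <= U i x < (f i).+1%:R / r.+1%:R].
  have GA f : G (A f) by exact: wrt_measurable_cell.
  have mA f : measurable (A f) by case: sG => _; apply; exact: GA.
  have c0 f i : 0 <= c f i by rewrite divr_ge0.
  have mS : bounded_measurable (fun x => \sum_f \1_(A f) x * h (c f) x).
    apply: bounded_measurable_sum => f; apply: bounded_measurableM; last exact: mh.
    exact: bounded_measurable_indic.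
  apply: (@le_trans _ _
      (\int[P]_x (\sum_f \1_(A f) x * h (c f) x + L / r.+1%:R))).
    apply: le_Rintegral => //.
    - exact: bounded_measurable_integrable.
    - apply: bounded_measurable_integrable => //.
      by apply: bounded_measurableD => //; exact: bounded_measurable_cst.
    move=> x _.
    have UN i : (Num.trunc (U i x * r.+1%:R) < N)%N.
      by rewrite ltnS le_truncn// ler_pM2r//; case/andP: (UD i x).
    pose f0 := [ffun i => Ordinal (UN i)].
    have Ux i : c f0 i <= U i x < (f0 i).+1%:R / r.+1%:R.
      rewrite /c ffunE/= ler_pdivrMr// ltr_pdivlMr//; apply: truncn_itv.
      by rewrite mulr_ge0//; case/andP: (UD i x).
    (* The cells are disjoint, so only the cell [f0] that contains the coefficients at [x]
       contributes. *)
    have -> : \sum_f \1_(A f) x * h (c f) x = h (c f0) x.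
      rewrite (bigD1 f0)//= big1 ?addr0; last first.
        move=> f ff0; rewrite indicE memNset ?mul0r// => Afx.
        case/eqP: ff0; apply/ffunP => i; apply: val_inj.
        rewrite ffunE/=; apply/esym/truncn_def.
        by have := Afx i; rewrite /c ler_pdivrMr// ltr_pdivlMr.
      by rewrite indicE mem_set ?mul1r.
    rewrite -lerBlDl; apply: le_trans (ler_norm _) _.
    apply: hL => i; first exact: UD.
      rewrite c0/=; apply: le_trans (_ : U i x <= D).
        by case/andP: (Ux i).
      by case/andP: (UD i x).
    have /andP[lo hi] := Ux i.
    rewrite ger0_norm ?subr_ge0//; apply/ltW; rewrite ltrBlDl.
    by apply: lt_le_trans hi _; rewrite -natr1 mulrDl mul1r.
  rewrite RintegralD//; last 2 first.
  - exact: bounded_measurable_integrable.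
  - by apply: bounded_measurable_integrable => //; exact: bounded_measurable_cst.
  rewrite Rintegral_cst//; have -> : fine (P setT) = 1 by rewrite probability_setT.
  rewrite mulr1 gerDr Rintegral_sum//; last first.
    move=> f; apply: bounded_measurableM; last exact: mh.
    exact: bounded_measurable_indic.
  by apply: sumr_le0 => f _; rewrite Rintegral_indicM; exact: h_le0.
rewrite leNgt; apply/negP => I0.
set J := \int[P]_x _ in bound I0.
(* If [J] were positive, this mesh would be finer than [J / |L|], contradicting the bound. *)
have := bound (Num.trunc (`|L| / J)); rewrite ler_pdivlMr ?ltr0n//.
apply/negP; rewrite -ltNge; apply: le_lt_trans (ler_norm L) _.
by rewrite -ltr_pdivrMl// mulrC truncnS_gt.
Qed.

(** On an event of [G], conditional expectations have the same integrals as the original variables,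
    so the almost sure inequality can be integrated. The versions [Xc], [Xc'] allow truncated
    increments to replace the given ones. *)
Lemma cond_expectation_le_integral (X X' Xc Xc' : T -> R) (a : R)
    (A : set T) :
  cond_expectation_le P G X a X' ->
  bounded_measurable Xc -> bounded_measurable Xc' ->
  {ae P, forall x, Xc x = X x} -> {ae P, forall x, Xc' x = X' x} ->
  G A -> \int[P]_(x in A) (Xc x - a * Xc' x) <= 0.
Proof.
move=> [Y [Y' [[iX mY iY YX] [iX' mY' iY' YX'] le_ae]]] mXc mXc' eX eX' GA.
have mA : measurable A by case: sG => _; exact.
have integralE (V W : T -> R) : P.-integrable setT (EFin \o W) ->
    bounded_measurable V -> {ae P, forall x, V x = W x} ->
    \int[P]_(x in A) V x = \int[P]_(x in A) W x.
  move=> iW [mV _] VW; congr fine; apply: ae_eq_integral => //.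
  - by apply/measurable_EFinP; exact: measurable_funS mV.
  - exact: measurable_funS (measurable_int _ iW).
  - by apply: filterS VW => x /= ->.
have EX : \int[P]_(x in A) Xc x = \int[P]_(x in A) Y x.
  by rewrite (integralE _ X)//; congr fine; rewrite YX.
have EX' : \int[P]_(x in A) Xc' x = \int[P]_(x in A) Y' x.
  by rewrite (integralE _ X')//; congr fine; rewrite YX'.
have iA (V : T -> R) : P.-integrable setT (EFin \o V) ->
    P.-integrable A (EFin \o V) by exact: integrableS.
have iaY' : P.-integrable A (EFin \o (fun x => a * Y' x)).
  have -> : EFin \o (fun x => a * Y' x) =
     (fun x => a%:E * (EFin \o Y') x)%E by apply/funext => x /=; rewrite EFinM.
  by apply: integrableZl => //; exact: iA.
have mcst := @bounded_measurable_cst _ T R a.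
rewrite RintegralB//; last 2 first.
- exact: bounded_measurable_integrable.
- by apply: bounded_measurable_integrable => //; exact: bounded_measurableM.
rewrite RintegralZl//; last exact: bounded_measurable_integrable.
rewrite EX EX' -RintegralZl ?subr_le0; [|by []|exact: iA].
rewrite -subr_ge0 -RintegralB//; last exact: iA.
have iB : P.-integrable A (EFin \o (fun x => a * Y' x - Y x)).
  have -> : EFin \o (fun x => a * Y' x - Y x) =
     ((EFin \o (fun x => (a * Y' x)%R)) \- (EFin \o Y))%E by [].
  by apply: integrableB => //; exact: iA.
(* The integrand is nonnegative only almost surely, so it is exchanged for its absolute value. *)
set g := EFin \o _ in iB; rewrite /Rintegral (ae_eq_integral (abse \o g) g)//.
- by apply: fine_ge0; apply: integral_ge0 => x _; exact: abse_ge0.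
- exact: measurable_int iB.
- by apply: measurableT_comp => //; exact: measurable_int iB.
- by apply: filterS le_ae => x /= h _; rewrite ger0_norm// subr_ge0.
Qed.

End RandomCoefficients.

(** * Real inequalities for the exponential of a small increment *)

Lemma expR_le_quadratic {R : realType} (x : R) :
  x <= 1 / 4 -> expR x <= 1 + x + x ^+ 2.
Proof.
(* Since [expR (- x / 2) >= 1 - x / 2 > 0], [expR x] is at most the inverse of [(1 - x / 2) ^+ 2]. A
   polynomial inequality remains. *)
move=> x4; have q0 : 0 < (1 - x / 2) ^+ 2 by rewrite exprn_gt0//; lra.
rewrite -(ler_pM2r q0); apply: (@le_trans _ _ 1).
  have e1 : expR x * expR (- (x / 2)) ^+ 2 = 1.
    by rewrite expr2 -!expRD -[RHS]expR0; congr expR; field.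
  rewrite -[leRHS]e1.
  rewrite ler_pM2l ?expR_gt0// lerXn2r ?nnegrE ?expR_ge0//; first by lra.
  by have := expR_ge1Dx (- (x / 2)); lra.
rewrite -subr_ge0.
have -> : (1 + x + x ^+ 2) * (1 - x / 2) ^+ 2 - 1 =
    x ^+ 2 * (1 - 3 * x + x ^+ 2) / 4 by field.
by rewrite divr_ge0// mulr_ge0 ?sqr_ge0//; have := sqr_ge0 x; lra.
Qed.

(* The exponential supermartingale inequality for one step, with [J], [S], [Q]
   standing for the sums of [w x], [w x^2], [w^2 x^2], and [E] for the maximal
   weight. The choice of [delta] balances the variance term [alpha Q] against
   the drift [- theta S]. *)
Lemma expR_increment_le {R : realType}
    (delta lambda theta alpha E M n J S Q r : R) :
  0 < delta -> 0 < lambda -> 0 < theta -> 1 <= alpha -> 0 < E -> 0 <= M ->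
  0 <= n -> 0 <= S -> delta * lambda * E * alpha = theta / 8 ->
  lambda <= theta / 2 -> lambda * M <= 1 / 4 -> theta * n * M <= 1 / 4 ->
  n * (lambda * M) ^+ 2 <= 1 -> S <= n * (E * M ^+ 2) -> J <= n * (E * M) ->
  Q <= E * S -> 0 <= r <= lambda ^+ 2 * S ->
  expR (delta * (lambda * J + r)) <=
  1 + delta * lambda * (J + theta * S) +
    2 * (delta * lambda) ^+ 2 * (J ^+ 2 - alpha * Q).
Proof.
move=> d0 l0 t0 al E0 M0 n0 S0 dE lt lM tM mM SE JE QS /andP[r0 rS].
have a0 : 0 < alpha by exact: lt_le_trans ltr01 al.
have [k kE] : exists k, k = delta * lambda * E by exists (delta * lambda * E).
rewrite -kE in dE.
have k0 : 0 < k by rewrite kE !mulr_gt0.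
have kt : k <= theta / 8 by rewrite -dE ler_peMr// ltW.
have [D DE] : exists D, D = delta * (lambda * J + r).
  by exists (delta * (lambda * J + r)).
rewrite -DE.
(* The two summands of [D] are at most 1/32 and 1/128, by [k <= theta / 8] and the smallness of
   [M]. *)
have D4 : D <= 1 / 4.
  have h1 : delta * (lambda * J) <= theta * n * M / 8.
    apply: (@le_trans _ _ (k * (n * M))).
      have -> : k * (n * M) = delta * (lambda * (n * (E * M))).
        by rewrite kE; ring.
      by rewrite !ler_pM2l.
    apply: le_trans (_ : theta / 8 * (n * M) <= _).
      by rewrite ler_wpM2r// mulr_ge0.
    by rewrite le_eqVlt; apply/orP; left; apply/eqP; field.
  have h2 : delta * r <= theta * n * M * (lambda * M) / 8.
    apply: (@le_trans _ _ (delta * (lambda ^+ 2 * (n * (E * M ^+ 2))))).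
      rewrite ler_pM2l//; apply: le_trans rS _.
      by rewrite ler_wpM2l// sqr_ge0.
    have -> : delta * (lambda ^+ 2 * (n * (E * M ^+ 2))) =
      k * (n * M * (lambda * M)) by rewrite kE; ring.
    apply: le_trans (_ : theta / 8 * (n * M * (lambda * M)) <= _).
      by rewrite ler_wpM2r// !mulr_ge0// ltW.
    by rewrite le_eqVlt; apply/orP; left; apply/eqP; field.
  have h3 : theta * n * M * (lambda * M) <= 1 / 4 * (1 / 4).
    by rewrite ler_pM// !mulr_ge0// ltW.
  by rewrite DE mulrDr; lra.
apply: le_trans (expR_le_quadratic D4) _.
have D2 : D ^+ 2 <= 2 * (delta * lambda) ^+ 2 * J ^+ 2 + 2 * (delta * r) ^+ 2.
  have -> : D = delta * lambda * J + delta * r by rewrite DE; ring.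
  by have := sqr_ge0 (delta * lambda * J - delta * r); lra.
have dl0 : 0 < delta * lambda by exact: mulr_gt0.
(* One factor [r] is bounded through [S] and the other through the crude bound on [S], which keeps
   the result linear in [S]. *)
have r2 : 2 * (delta * r) ^+ 2 <= delta * lambda * S * (theta / 4).
  apply: (@le_trans _ _ (2 * (delta ^+ 2 * (lambda ^+ 2 * S *
      (lambda ^+ 2 * (n * (E * M ^+ 2))))))).
    rewrite exprMn [r ^+ 2]expr2 ler_pM2l// ler_pM2l ?exprn_gt0// ler_pM//.
    by apply: le_trans rS _; rewrite ler_wpM2l// sqr_ge0.
  have -> : 2 * (delta ^+ 2 * (lambda ^+ 2 * S *
      (lambda ^+ 2 * (n * (E * M ^+ 2))))) =
    delta * lambda * S * (2 * k * (n * (lambda * M) ^+ 2)).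
    by rewrite kE; ring.
  rewrite ler_wpM2l ?(mulr_ge0 (ltW dl0))//.
  apply: le_trans (_ : 2 * k * 1 <= _); last by lra.
  by rewrite ler_wpM2l// mulr_ge0// ltW.
have Q2 : 2 * (delta * lambda) ^+ 2 * (alpha * Q) <=
    delta * lambda * S * (theta / 4).
  apply: (@le_trans _ _ (2 * (delta * lambda) ^+ 2 * (alpha * (E * S)))).
    by rewrite ler_wpM2l// ?ler_pM2l// mulr_ge0// sqr_ge0.
  have -> : 2 * (delta * lambda) ^+ 2 * (alpha * (E * S)) =
    delta * lambda * S * (2 * (k * alpha)) by rewrite kE; ring.
  by rewrite dE ler_wpM2l ?(mulr_ge0 (ltW dl0))//; lra.
have D1 : D <= delta * lambda * J + delta * lambda * S * (theta / 2).
  have -> : D = delta * lambda * J + delta * r by rewrite DE; ring.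
  rewrite lerD2l; apply: (@le_trans _ _ (delta * (lambda ^+ 2 * S))).
    by rewrite ler_pM2l.
  have -> : delta * (lambda ^+ 2 * S) = delta * lambda * S * lambda by ring.
  by rewrite ler_wpM2l ?(mulr_ge0 (ltW dl0)).
(* The drift term [delta * lambda * theta * S] is spent completely: one half on [D1], where
   [lambda <= theta / 2] enters, and one quarter each on [r2] and [Q2]. *)
have -> : 1 + delta * lambda * (J + theta * S) +
   2 * (delta * lambda) ^+ 2 * (J ^+ 2 - alpha * Q) =
   1 + (delta * lambda * J + delta * lambda * S * theta) +
   (2 * (delta * lambda) ^+ 2 * J ^+ 2 -
   2 * (delta * lambda) ^+ 2 * (alpha * Q)) by ring.
by lra.
Qed.

Section FrozenStep.
Context {R : realType}.
Implicit Types (B M lambda theta alpha : R).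

Definition frozen_step B (y x : R) : R := if y < B then y + x else y.

(** Up to the factor [lambda], this is the derivative of the potential in a coordinate that still
    moves. The value 0 on frozen coordinates keeps the weight below [expR (lambda * B)] even when a
    coordinate has overshot [B]. *)
Definition active_weight lambda B (y : R) : R :=
  if y < B then expR (lambda * y) else 0.

Definition potential lambda (m : nat) (y : 'I_m -> R) : R :=
  \sum_(i < m) expR (lambda * y i).

Definition rate lambda alpha theta B : R :=
  theta / (8 * alpha * lambda * expR (lambda * B)).

Lemma active_weight_ge0 lambda B y : 0 <= active_weight lambda B y.
Proof. by rewrite /active_weight; case: ifP => _; rewrite ?expR_ge0. Qed.

Lemma active_weight_le lambda B y : 0 <= lambda ->
  active_weight lambda B y <= expR (lambda * B).
Proof.
move=> l0; rewrite /active_weight; case: ifP => yB; last exact: expR_ge0.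
by rewrite ler_expR ler_wpM2l// ltW.
Qed.

Section OneStep.
Variables (lambda alpha theta B M : R) (m : nat) (y x : 'I_m -> R).
Hypotheses (l0 : 0 < lambda) (M0 : 0 <= M) (lM : lambda * M <= 1 / 4).
Hypothesis xM : forall i, `|x i| <= M.

Let w i := active_weight lambda B (y i).

(** Coordinatewise, [1 + z <= expR z <= 1 + z + z ^+ 2] for [z = lambda * x i], scaled by
    [expR (lambda * y i)]. Frozen coordinates contribute 0 throughout. *)
Lemma potential_frozen_step :
  0 <= potential lambda (fun i => frozen_step B (y i) (x i)) -
       potential lambda y - lambda * \sum_(i < m) w i * x i
    <= lambda ^+ 2 * \sum_(i < m) w i * x i ^+ 2.
Proof.
rewrite /potential !mulr_sumr -!sumrB.
have H i : 0 <= expR (lambda * frozen_step B (y i) (x i)) - expR (lambda * y i)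
     - lambda * (w i * x i) <= lambda ^+ 2 * (w i * x i ^+ 2).
  rewrite /w /frozen_step /active_weight; case: ifP => yB; last first.
    by rewrite !(mul0r, mulr0, subrr, lexx).
  have lx : lambda * x i <= 1 / 4.
    by apply: le_trans lM; rewrite ler_pM2l// (le_trans (ler_norm _)).
  have h1 := expR_ge1Dx (lambda * x i).
  have h2 := expR_le_quadratic lx.
  rewrite mulrDr expRD.
  set e := expR (lambda * y i); set f := expR _ in h1 h2 *.
  have -> : e * f - e - lambda * (e * x i) = e * (f - 1 - lambda * x i) by ring.
  have -> : lambda ^+ 2 * (e * x i ^+ 2) = e * (lambda * x i) ^+ 2 by ring.
  have e0 : 0 < e by exact: expR_gt0.
  by rewrite mulr_ge0 ?ler_pM2l ?(ltW e0)//=; lra.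
apply/andP; split; last by apply: ler_sum => i _; case/andP: (H i).
by apply: sumr_ge0 => i _; case/andP: (H i).
Qed.

Hypotheses (lt : lambda <= theta / 2) (al : 1 <= alpha).
Hypothesis tM : theta * m%:R * M <= 1 / 4.
Hypothesis mM : m%:R * (lambda * M) ^+ 2 <= 1.

Let delta := rate lambda alpha theta B.
Let V := expR (delta * potential lambda y).
Let H := expR (delta / 2 * potential lambda y).

(** This is [expR_increment_le] multiplied by [V]. The factor is moved into the coefficients, as [V]
    in the linear term and as its square root [H] in the quadratic one, so that conditions (ii) and
    (i) apply with coefficients depending on [y] alone. *)
Lemma exp_potential_frozen_step :
  expR (delta * potential lambda (fun i => frozen_step B (y i) (x i))) <=
  V + delta * lambda * (\sum_(i < m) V * w i * (x i - (- theta) * x i ^+ 2))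
    + 2 * (delta * lambda) ^+ 2 *
      ((\sum_(i < m) H * w i * x i) ^+ 2
       - alpha * \sum_(i < m) (H * w i) ^+ 2 * x i ^+ 2).
Proof.
have := potential_frozen_step.
set Phi := potential _ y; set Phi' := potential _ _.
set J := \sum_(i < m) w i * x i; set S := \sum_(i < m) w i * x i ^+ 2.
pose Q := \sum_(i < m) w i ^+ 2 * x i ^+ 2.
set r := Phi' - Phi - _ => /andP[r0 rS].
pose E := expR (lambda * B).
have E0 : 0 < E by exact: expR_gt0.
have w0 i : 0 <= w i by exact: active_weight_ge0.
have wE i : w i <= E by apply: active_weight_le; exact: ltW.
have x2 i : x i ^+ 2 <= M ^+ 2 by rewrite -real_normK ?num_real// lerXn2r ?nnegrE.
have S0 : 0 <= S by apply: sumr_ge0 => i _; rewrite mulr_ge0// sqr_ge0.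
have card (c : R) : \sum_(i < m) c = m%:R * c.
  by rewrite sumr_const card_ord mulr_natl.
have SE : S <= m%:R * (E * M ^+ 2).
  by rewrite -card; apply: ler_sum => i _; rewrite ler_pM// sqr_ge0.
have JE : J <= m%:R * (E * M).
  rewrite -card; apply: ler_sum => i _.
  by rewrite (le_trans (ler_norm _))// normrM (ger0_norm (w0 i)) ler_pM.
have QS : Q <= E * S.
  rewrite mulr_sumr; apply: ler_sum => i _.
  by rewrite mulrA ler_wpM2r ?sqr_ge0// expr2 ler_wpM2r.
have -> : \sum_(i < m) V * w i * (x i - - theta * x i ^+ 2) =
    V * (J + theta * S).
  rewrite mulrDr !mulr_sumr -big_split/=; apply: eq_bigr => i _; ring.
have HV : H ^+ 2 = V.
  by rewrite expr2 -expRD; congr expR; field.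
have -> : (\sum_(i < m) H * w i * x i) ^+ 2 = V * J ^+ 2.
  rewrite -HV -exprMn mulr_sumr; congr (_ ^+ 2).
  by apply: eq_bigr => i _; rewrite mulrA.
have -> : \sum_(i < m) (H * w i) ^+ 2 * x i ^+ 2 = V * Q.
  by rewrite mulr_sumr; apply: eq_bigr => i _; rewrite exprMn HV mulrA.
have t0 : 0 < theta by move: (lt_le_trans l0 lt); rewrite pmulr_lgt0 ?invr_gt0.
have d0 : 0 < delta by rewrite divr_gt0// !mulr_gt0// (lt_le_trans ltr01 al).
have dE : delta * lambda * E * alpha = theta / 8.
  rewrite /delta /rate -/E; field.
  by rewrite !gt_eqF// (lt_le_trans ltr01 al).
have -> : delta * Phi' = delta * Phi + delta * (lambda * J + r).
  by rewrite /r; ring.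
have -> : V + delta * lambda * (V * (J + theta * S)) +
    2 * (delta * lambda) ^+ 2 * (V * J ^+ 2 - alpha * (V * Q)) =
  V * (1 + delta * lambda * (J + theta * S) +
    2 * (delta * lambda) ^+ 2 * (J ^+ 2 - alpha * Q)) by ring.
rewrite expRD ler_pM2l ?expR_gt0//.
by apply: (@expR_increment_le _ _ _ _ _ E M m%:R) => //; rewrite r0.
Qed.

End OneStep.

End FrozenStep.

(** * Pairwise independence with random coefficients *)

Section PairwiseIndependentCoefficients.
Context {d : measure_display} {T : measurableType d} {R : realType}.
Variables (P : probability T R) (G : set (set T)).
Hypothesis sG : Defs.sub_sigma_algebra G.
Variables (alpha theta : R) (m : nat) (X : T -> 'rV[R]_m).
Hypothesis a0 : 0 <= alpha.
Hypothesis t0 : 0 <= theta.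
Hypothesis indepX : cond_pairwise_independent P G alpha theta X.
Variables (M : R) (Xb : 'I_m -> T -> R).
Hypothesis mXb : forall i, measurable_fun setT (Xb i).
Hypothesis XbM : forall i x, `|Xb i x| <= M.
Hypothesis XbX : {ae P, forall x i, Xb i x = X x ord0 i}.
Variables (U : 'I_m -> T -> R) (D : R).
Hypothesis mU : forall i, wrt_measurable G (U i).
Hypothesis UD : forall i x, 0 <= U i x <= D.

Let mXb' i : bounded_measurable (Xb i).
Proof. by split; [exact: mXb | exists M => x; exact: XbM]. Qed.

Let mU' i : bounded_measurable (U i).
Proof.
split; first exact: wrt_measurable_fun (mU i).
by exists D => x; have /andP[? ?] := UD i x; rewrite ger0_norm.
Qed.

Let mcst (r : R) : bounded_measurable (fun _ : T => r).
Proof. exact: bounded_measurable_cst. Qed.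

Lemma random_coefficient_drift :
  \int[P]_x (\sum_(i < m) U i x * (Xb i x - (- theta) * Xb i x ^+ 2)) <= 0.
Proof.
have mdrift i : bounded_measurable (fun x => Xb i x - (- theta) * Xb i x ^+ 2).
  apply: bounded_measurableB => //; apply: bounded_measurableM => //.
  exact: bounded_measurableX.
(* The Lipschitz constant bounds each of the [m] drift terms by [M + theta * M ^+ 2]. *)
apply: (@random_coefficient_le0 _ _ _ P G sG 'I_m
  (fun c x => \sum_(i < m) c i * (Xb i x - (- theta) * Xb i x ^+ 2)) U D
  (m%:R * (M + theta * M ^+ 2))) => //.
- by move=> c _; apply: bounded_measurable_sum => i; exact: bounded_measurableM.
- move=> c A c0 GA; have mA : measurable A by case: sG => _; exact.
  rewrite Rintegral_sum//; last by move=> i; exact: bounded_measurableM.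
  apply: sumr_le0 => i _; rewrite RintegralZl//; last first.
    exact: bounded_measurable_integrable.
  (* Condition (ii) is one-sided, so the sign of the coefficient matters here. *)
  rewrite mulr_ge0_le0//.
  apply: (cond_expectation_le_integral sG (indepX.2 i)) => //.
  + exact: bounded_measurableX.
  + by apply: filterS XbX => x.
  + by apply: filterS XbX => x /= ->.
- move=> u v e x uD vD uve; rewrite -sumrB.
  apply: le_trans (ler_norm_sum _ _ _) _.
  apply: le_trans (_ : \sum_(i < m) (M + theta * M ^+ 2) * e <= _); last first.
    by rewrite sumr_const card_ord -mulrA mulr_natl.
  apply: ler_sum => i _; rewrite -mulrBl mulrC normrM ler_pM//.
  rewrite mulNr opprK; apply: le_trans (ler_normD _ _) _; apply: lerD => //.
  by rewrite normrM normrX ger0_norm// ler_wpM2l// lerXn2r ?nnegrE// (le_trans _ (XbM i x)).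
- by apply: bounded_measurable_sum => i; exact: bounded_measurableM.
Qed.

Lemma random_coefficient_variance :
  \int[P]_x ((\sum_(i < m) U i x * Xb i x) ^+ 2
             - alpha * \sum_(i < m) U i x ^+ 2 * Xb i x ^+ 2) <= 0.
Proof.
have mquad (c : 'I_m -> T -> R) : (forall i, bounded_measurable (c i)) ->
    bounded_measurable (fun x => (\sum_(i < m) c i x * Xb i x) ^+ 2
      - alpha * \sum_(i < m) c i x ^+ 2 * Xb i x ^+ 2).
  move=> mc; apply: bounded_measurableB.
    apply: bounded_measurableX; apply: bounded_measurable_sum => i.
    exact: bounded_measurableM.
  apply: bounded_measurableM => //; apply: bounded_measurable_sum => i.
  by apply: bounded_measurableM; exact: bounded_measurableX.
apply: (@random_coefficient_le0 _ _ _ P G sG 'I_m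
  (fun c x => (\sum_(i < m) c i * Xb i x) ^+ 2
              - alpha * \sum_(i < m) c i ^+ 2 * Xb i x ^+ 2) U D
  ((m%:R * M) * (m%:R * (2 * D * M)) + alpha * (m%:R * (2 * D * M ^+ 2)))) => //.
- by move=> c _; exact: (mquad (fun i _ => c i)).
- move=> c A c0 GA.
  have := cond_expectation_le_integral sG (indepX.1 (\row_i c i)).
  apply => //.
  + apply: bounded_measurableX; apply: bounded_measurable_sum => i.
    exact: bounded_measurableM.
  + apply: bounded_measurable_sum => i.
    by apply: bounded_measurableM => //; exact: bounded_measurableX.
  + apply: filterS XbX => x /= XX; congr (_ ^+ 2).
    by apply: eq_bigr => i _; rewrite mxE XX.
  + apply: filterS XbX => x /= XX.
    by apply: eq_bigr => i _; rewrite mxE XX.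
- move=> u v e x uD vD uve.
  have sumM (f : 'I_m -> R) b : (forall i, `|f i| <= b) ->
      `|\sum_(i < m) f i| <= m%:R * b.
    move=> fb; apply: le_trans (ler_norm_sum _ _ _) _.
    apply: le_trans (_ : \sum_(i < m) b <= _); first exact: ler_sum.
    by rewrite sumr_const card_ord mulr_natl.
  have uvD i : `|u i + v i| <= 2 * D.
    have /andP[u0 u1] := uD i; have /andP[v0 v1] := vD i.
    by rewrite ger0_norm ?addr_ge0// mulr_natl mulr2n lerD.
  have X2M i : `|Xb i x ^+ 2| <= M ^+ 2.
    by rewrite normrX lerXn2r ?nnegrE// (le_trans _ (XbM i x)).
  set a := \sum_(i < m) u i * _; set b := \sum_(i < m) v i * _.
  set a' := \sum_(i < m) u i ^+ 2 * _; set b' := \sum_(i < m) v i ^+ 2 * _.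
  (* The Lipschitz constant comes from factoring differences of squares, here and again in each term
     of [a' - b']; sums of two coefficients are at most [2 * D]. *)
  have -> : a ^+ 2 - alpha * a' - (b ^+ 2 - alpha * b') =
     (a - b) * (a + b) - alpha * (a' - b') by ring.
  apply: le_trans (ler_normB _ _) _; rewrite [leRHS]mulrDl; apply: lerD.
    rewrite normrM mulrAC ler_pM//.
      rewrite -sumrB -mulrA; apply: sumM => i.
      by rewrite -mulrBl normrM mulrC ler_pM.
    rewrite -big_split/=; apply: sumM => i.
    by rewrite -mulrDl normrM ler_pM.
  rewrite normrM ger0_norm// -mulrA ler_wpM2l// -sumrB -mulrA; apply: sumM => i.
  by rewrite -mulrBl subr_sqr normrM [X in X * _]normrM -mulrA mulrC !ler_pM.
- exact: mquad.
Qed.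

End PairwiseIndependentCoefficients.

Definition truncate {R : realType} (M x : R) : R := if `|x| <= M then x else 0.

Lemma truncate_le {R : realType} (M x : R) : 0 <= M -> `|truncate M x| <= M.
Proof. by move=> M0; rewrite /truncate; case: ifP => // _; rewrite normr0. Qed.

(* Coordinate [i] stops moving once it reaches [B]. Capping the initial value
   at 0 and truncating the increments changes the process only on a null set,
   and makes all bounds hold everywhere. *)
Fixpoint frozen {R : realType} {T : Type} (B M : R) (m : nat)
    (Z : nat -> T -> 'rV[R]_m) (k : nat) (x : T) (i : 'I_m) : R :=
  if k is k'.+1 then
    frozen_step B (frozen B M Z k' x i)
      (truncate M ((Z k'.+1 x - Z k' x) ord0 i))
  else Num.min (Z 0%N x ord0 i) 0.

Lemma entry_le_norm {R : realType} (m : nat) (v : 'rV[R]_m) (i : 'I_m) :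
  `|v ord0 i| <= `|v|.
Proof.
rewrite [leRHS]/Num.Def.normr/= mx_normrE.
exact: (le_bigmax 0 (fun ij => `|v ij.1 ij.2|) (ord0, i)).
Qed.

Section FrozenProcess.
Context {d : measure_display} {T : measurableType d} {R : realType}.
Variables (P : probability T R) (F : nat -> set (set T)).
Hypothesis filtF : filtration F.
Variables (m : nat) (Z : nat -> T -> 'rV[R]_m).
Hypothesis adZ :
  forall k i, wrt_measurable (F k) (fun x => Z k x ord0 i).
Variables (alpha theta lambda B M : R).
Hypotheses (B0 : 0 <= B) (M0 : 0 <= M).

Let sF k : Defs.sub_sigma_algebra (F k) := filtF.1 k.

Let Y := frozen B M Z.

Lemma wrt_measurable_increment k i :
  wrt_measurable (F k.+1)
    (fun x => truncate M ((Z k.+1 x - Z k x) ord0 i)).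
Proof.
have -> : (fun x => truncate M ((Z k.+1 x - Z k x) ord0 i)) =
    (fun x => truncate M (Z k.+1 x ord0 i - Z k x ord0 i)).
  by apply/funext => x; rewrite !mxE.
apply/(wrt_measurableE (sF k.+1)).
have m1 := (wrt_measurableE (sF k.+1) _).1 (adZ k.+1 i).
have m2 : measurable_fun (setT : set (g_sigma_algebraType (F k.+1)))
    (fun x => Z k x ord0 i).
  apply/(wrt_measurableE (sF k.+1)) => A mA; apply: filtF.2; exact: adZ.
have mD := measurable_funB m1 m2.
apply: measurable_fun_ifT => //.
by apply: measurable_fun_ler => //; exact: measurableT_comp.
Qed.

Lemma wrt_measurable_frozen k i : wrt_measurable (F k) (fun x => Y k x i).
Proof.
elim: k => [|k ih].
  apply/(wrt_measurableE (sF 0)); apply: measurable_minr => //.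
  by apply/(wrt_measurableE (sF 0)); exact: adZ.
apply/(wrt_measurableE (sF k.+1)).
have mY : measurable_fun (setT : set (g_sigma_algebraType (F k.+1)))
    (fun x => Y k x i).
  by apply/(wrt_measurableE (sF k.+1)) => A mA; apply: filtF.2; exact: ih.
apply: measurable_fun_ifT => //; first exact: measurable_fun_ltr.
apply: measurable_funD => //.
by apply/(wrt_measurableE (sF k.+1)); exact: wrt_measurable_increment.
Qed.

(** A coordinate moves only from below [B], so it overshoots by at most one truncated increment.
    This makes the exponential of the potential bounded. *)
Lemma frozen_le k x i : Y k x i <= B + M.
Proof.
elim: k => [|k ih]; first by rewrite /Y/= ge_min addr_ge0 ?orbT.
rewrite /Y/= /frozen_step; case: ifP => [yB|_]; last exact: ih.
rewrite lerD ?(ltW yB)//.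
by rewrite (le_trans (ler_norm _))// truncate_le.
Qed.

Lemma wrt_measurable_potential k :
  wrt_measurable (F k) (fun x => potential lambda (Y k x)).
Proof.
apply/(wrt_measurableE (sF k)); apply: measurable_sum => i.
apply: measurableT_comp => //; apply: measurable_funM => //.
by apply/(wrt_measurableE (sF k)); exact: wrt_measurable_frozen.
Qed.

Hypotheses (l0 : 0 < lambda) (lt : lambda <= theta / 2) (al : 1 <= alpha).
Hypotheses (lM : lambda * M <= 1 / 4) (tM : theta * m%:R * M <= 1 / 4).
Hypothesis mM : m%:R * (lambda * M) ^+ 2 <= 1.

Let delta := rate lambda alpha theta B.

Let t0 : 0 < theta.
Proof. by move: (lt_le_trans l0 lt); rewrite pmulr_lgt0 ?invr_gt0. Qed.

Lemma rate_gt0 : 0 < delta.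
Proof. by rewrite divr_gt0// !mulr_gt0 ?expR_gt0// (lt_le_trans ltr01 al). Qed.

Lemma potential_frozen_le k x :
  potential lambda (Y k x) <= m%:R * expR (lambda * (B + M)).
Proof.
rewrite mulr_natl -[X in _ *+ X]card_ord -sumr_const; apply: ler_sum => i _.
by rewrite ler_expR ler_wpM2l ?frozen_le// ltW.
Qed.

Lemma wrt_measurable_expR_potential k c :
  wrt_measurable (F k) (fun x => expR (c * potential lambda (Y k x))).
Proof.
apply/(wrt_measurableE (sF k)); apply: measurableT_comp => //.
apply: measurable_funM => //.
by apply/(wrt_measurableE (sF k)); exact: wrt_measurable_potential.
Qed.

Lemma expR_potential_le k c x : 0 <= c ->
  expR (c * potential lambda (Y k x)) <=
  expR (c * (m%:R * expR (lambda * (B + M)))).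
Proof. by move=> c0; rewrite ler_expR ler_wpM2l// potential_frozen_le. Qed.

Lemma bounded_measurable_expR_potential k c : 0 <= c ->
  bounded_measurable (fun x => expR (c * potential lambda (Y k x))).
Proof.
move=> c0; split.
  exact: (wrt_measurable_fun (sF k) (wrt_measurable_expR_potential k c)).
exists (expR (c * (m%:R * expR (lambda * (B + M))))) => x.
by rewrite ger0_norm ?expR_ge0// expR_potential_le.
Qed.

(** Integrates [exp_potential_frozen_step]: its coefficients are measurable with respect to [F k],
    so the drift and variance terms have nonpositive integrals. Comparing unconditional expectations
    suffices for Markov's inequality at the final time. *)
Lemma frozen_supermartingale_step k :
  cond_pairwise_independent P (F k) alpha theta (fun x => Z k.+1 x - Z k x) ->
  {ae P, forall x, `|Z k.+1 x - Z k x| <= M} ->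
  \int[P]_x expR (delta * potential lambda (Y k.+1 x)) <=
  \int[P]_x expR (delta * potential lambda (Y k x)).
Proof.
move=> indep stepM.
pose Xb i x := truncate M ((Z k.+1 x - Z k x) ord0 i).
have mXb i : measurable_fun setT (Xb i).
  exact: (wrt_measurable_fun (sF k.+1) (wrt_measurable_increment k i)).
have XbM i x : `|Xb i x| <= M by exact: truncate_le.
have XbX : {ae P, forall x i, Xb i x = (Z k.+1 x - Z k x) ord0 i}.
  apply: filterS stepM => x /= xM i; rewrite /Xb /truncate ifT//.
  exact: le_trans (entry_le_norm _ _) xM.
pose w x i := active_weight lambda B (Y k x i).
have mw i : wrt_measurable (F k) (w^~ i).
  apply/(wrt_measurableE (sF k)).
  have mY : measurable_fun (setT : set (g_sigma_algebraType (F k)))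
      (fun x => Y k x i).
    by apply/(wrt_measurableE (sF k)); exact: wrt_measurable_frozen.
  apply: measurable_fun_ifT => //; first exact: measurable_fun_ltr.
  by apply: measurableT_comp => //; exact: measurable_funM.
(* Taking [c = delta] gives the drift coefficients, [c = delta / 2] those of the quadratic form. *)
pose U c i x := expR (c * potential lambda (Y k x)) * w x i.
pose D c := expR (c * (m%:R * expR (lambda * (B + M)))) * expR (lambda * B).
have mU c i : wrt_measurable (F k) (U c i).
  apply/(wrt_measurableE (sF k)); apply: measurable_funM.
    apply/(wrt_measurableE (sF k)); exact: wrt_measurable_expR_potential.
  exact/(wrt_measurableE (sF k)).
have UD c i x : 0 <= c -> 0 <= U c i x <= D c.
  move=> c0; have w0 := active_weight_ge0 lambda B (Y k x i).
  rewrite mulr_ge0 ?expR_ge0//= ler_pM ?expR_ge0 ?expR_potential_le//.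
  by apply: active_weight_le; exact: ltW.
have a0 : 0 <= alpha by exact: le_trans ler01 al.
have d0 : 0 <= delta by apply/ltW/rate_gt0.
have d20 : 0 <= delta / 2 by exact: divr_ge0.
have mX i : bounded_measurable (Xb i).
  by split=> //; exists M => x; exact: XbM.
have mbU c i : 0 <= c -> bounded_measurable (U c i).
  move=> c0; split; first exact: (wrt_measurable_fun (sF k) (mU c i)).
  by exists (D c) => x; have /andP[? ?] := UD c i x c0; rewrite ger0_norm.
have mcst (r : R) : bounded_measurable (fun _ : T => r).
  exact: bounded_measurable_cst.
pose drift x :=
  \sum_(i < m) U delta i x * (Xb i x - (- theta) * Xb i x ^+ 2).
pose variance x := (\sum_(i < m) U (delta / 2) i x * Xb i x) ^+ 2
    - alpha * \sum_(i < m) U (delta / 2) i x ^+ 2 * Xb i x ^+ 2.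
have mdrift : bounded_measurable drift.
  apply: bounded_measurable_sum => i; apply: bounded_measurableM.
    exact: mbU.
  apply: bounded_measurableB => //; apply: bounded_measurableM => //.
  exact: bounded_measurableX.
have mvar : bounded_measurable variance.
  apply: bounded_measurableB.
    apply: bounded_measurableX; apply: bounded_measurable_sum => i.
    by apply: bounded_measurableM => //; exact: mbU.
  apply: bounded_measurableM => //; apply: bounded_measurable_sum => i.
  by apply: bounded_measurableM; apply: bounded_measurableX => //; exact: mbU.
have drift_le0 : \int[P]_x drift x <= 0.
  apply: (@random_coefficient_drift _ _ _ P (F k) (sF k) alpha theta m _ _
    indep M Xb mXb XbM XbX (U delta) (D delta)) => //; first exact: ltW.
  by move=> i x; exact: UD.
have var_le0 : \int[P]_x variance x <= 0.
  apply: (@random_coefficient_variance _ _ _ P (F k) (sF k) alpha theta m _ a0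
    indep M Xb mXb XbM XbX (U (delta / 2)) (D (delta / 2))) => //.
  by move=> i x; exact: UD.
have mV := bounded_measurable_expR_potential k d0.
have int f : bounded_measurable f -> P.-integrable setT (EFin \o f).
  exact: bounded_measurable_integrable.
pose a := delta * lambda; pose b := 2 * a ^+ 2.
have m1 : bounded_measurable (fun x => a * drift x) by exact: bounded_measurableM.
have m2 : bounded_measurable (fun x => b * variance x).
  exact: bounded_measurableM.
have m3 := bounded_measurableD mV m1.
apply: le_trans (_ : \int[P]_x (expR (delta * potential lambda (Y k x))
    + a * drift x + b * variance x) <= _).
  apply: le_Rintegral => //.
  - by apply: int; exact: bounded_measurable_expR_potential.
  - by apply: int; exact: bounded_measurableD.
  move=> x _.
  exact: (@exp_potential_frozen_step _ lambda alpha theta B M m (Y k x) (Xb^~ x)).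
rewrite RintegralD ?RintegralD ?RintegralZl//; do ?exact: int.
have a_ge0 : 0 <= a by rewrite mulr_ge0// ltW.
have b_ge0 : 0 <= b by rewrite mulr_ge0// sqr_ge0.
rewrite -addrA gerDl -[leRHS]addr0 lerD//; exact: mulr_ge0_le0.
Qed.

Lemma frozen_supermartingale N :
  (forall k, (k < N)%N -> cond_pairwise_independent P (F k) alpha theta
     (fun x => Z k.+1 x - Z k x)) ->
  (forall k, (k < N)%N -> {ae P, forall x, `|Z k.+1 x - Z k x| <= M}) ->
  \int[P]_x expR (delta * potential lambda (Y N x)) <= expR (delta * m%:R).
Proof.
have d0 : 0 <= delta by apply/ltW/rate_gt0.
elim: N => [_ _|N ih indep stepM].
  apply: le_trans (_ : \int[P]_x expR (delta * m%:R) <= _); last first.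
    rewrite Rintegral_cst//; have -> : fine (P setT) = 1.
      by rewrite probability_setT.
    by rewrite mulr1.
  apply: le_Rintegral => //.
  - apply: bounded_measurable_integrable => //.
    exact: bounded_measurable_expR_potential.
  - by apply: bounded_measurable_integrable => //; exact: bounded_measurable_cst.
  (* The initial values are capped at 0, so each of the [m] exponentials starts at most at 1. *)
  move=> x _; rewrite ler_expR ler_wpM2l//.
  rewrite -[X in _ <= X%:R]card_ord -sumr_const; apply: ler_sum => i _.
  by rewrite expR_le1 mulr_ge0_le0 ?(ltW l0)//= ge_min lexx orbT.
apply: le_trans (frozen_supermartingale_step (indep N _) (stepM N _)) _ => //.
by apply: ih => k kN; [apply: indep|apply: stepM]; exact: ltnW.
Qed.

End FrozenProcess.

(** * Bad coordinates of the original process *)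

Lemma bad_frozen {R : realType} {T : Type} (B M : R) (m N : nat)
    (Z : nat -> T -> 'rV[R]_m) (x : T) (i : 'I_m) :
  0 < B -> Z 0%N x ord0 i <= 0 ->
  (forall k, (k < N)%N -> `|Z k.+1 x - Z k x| <= M) ->
  (exists2 k, (k <= N)%N & B <= Z k x ord0 i) ->
  B <= frozen B M Z N x i.
Proof.
move=> B0 Z0 stepM.
suff: B <= frozen B M Z N x i \/
    frozen B M Z N x i = Z N x ord0 i /\
    (forall k, (k <= N)%N -> Z k x ord0 i < B).
  by case=> // -[_ ZB] [k kN]; rewrite leNgt ZB.
elim: N stepM => [_|N ih stepM].
  right; split; first by rewrite /= min_l.
  by move=> k; rewrite leqn0 => /eqP ->; exact: le_lt_trans Z0 B0.
rewrite /= /frozen_step.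
case: ih => [k kN|BY|[YZ ZB]]; first by apply: stepM; exact: ltnW.
  by left; rewrite ltNge BY.
rewrite YZ ZB// /truncate ifT; last first.
  by apply: le_trans (entry_le_norm _ _) _; exact: stepM.
have -> : Z N x ord0 i + (Z N.+1 x - Z N x) ord0 i = Z N.+1 x ord0 i.
  by rewrite !mxE; ring.
case: (leP B (Z N.+1 x ord0 i)) => h; first by left.
right; split=> // k; rewrite leq_eqVlt => /predU1P[-> //|].
by rewrite ltnS; exact: ZB.
Qed.

Section EverBad.
Context {d : measure_display} {T : measurableType d} {R : realType}.
Variables (m : nat) (Z : nat -> T -> 'rV[R]_m) (n : nat) (dt B : R).
Hypothesis mZ : forall k i, measurable_fun setT (fun x => Z k x ord0 i).

(** The count is a finite sum of indicators of countable unions. Measurability is needed to pass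
    from the complement to the event itself. *)
Lemma measurable_card_ever_bad (c : R) :
  measurable [set x | #|ever_bad n dt B Z x|%:R <= c].
Proof.
pose E i := [set x | exists k : nat, k%:R * dt <= n%:R /\ B <= Z k x ord0 i].
have mE i : measurable (E i).
  rewrite (_ : E i = \bigcup_(k in [set k : nat | k%:R * dt <= n%:R])
      ((fun x => Z k x ord0 i) @^-1` `[B, +oo[)).
    apply: bigcup_measurable => k _; rewrite -[X in measurable X]setTI.
    by apply: mZ => //; exact: measurable_itv.
  apply/seteqP; split=> x /=.
    by move=> [k [kn ZB]]; exists k => //=; rewrite in_itv/= ZB.
  by move=> [k kn /=]; rewrite in_itv/= andbT => ZB; exists k.
have cardE x : #|ever_bad n dt B Z x|%:R = \sum_(i < m) \1_(E i) x :> R.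
  rewrite -sum1_card natr_sum big_mkcond/=; apply: eq_bigr => i _.
  rewrite indicE unfold_in /ever_bad/=.
  case: asboolP => h; first by rewrite mem_set.
  by rewrite memNset.
have mS : measurable_fun setT (fun x => \sum_(i < m) \1_(E i) x : R).
  by apply: measurable_sum => i; exact: measurable_indic.
rewrite (_ : [set x | _] = (fun x => \sum_(i < m) \1_(E i) x) @^-1` `]-oo, c]).
  by rewrite -[X in measurable X]setTI; apply: mS => //; exact: measurable_itv.
by apply/seteqP; split=> x /=; rewrite in_itv/= cardE.
Qed.

End EverBad.

(** * The tail bound for the number of bad coordinates *)

Section ManyBad.
Context {d : measure_display} {T : measurableType d} {R : realType}.
Variables (P : probability T R) (F : nat -> set (set T)).
Hypothesis filtF : filtration F.
Variables (m : nat) (Z : nat -> T -> 'rV[R]_m).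
Hypothesis adZ :
  forall k i, wrt_measurable (F k) (fun x => Z k x ord0 i).
Variables (alpha theta lambda B M dt : R) (n q : nat).
Hypotheses (B0 : 0 < B) (M0 : 0 <= M) (dt0 : 0 < dt) (n0 : (0 < n)%N).
Hypotheses (l0 : 0 < lambda) (lt : lambda <= theta / 2) (al : 1 <= alpha).
Hypotheses (lM : lambda * M <= 1 / 4) (tM : theta * m%:R * M <= 1 / 4).
Hypothesis mM : m%:R * (lambda * M) ^+ 2 <= 1.
Hypothesis Z0 : {ae P, forall x, forall i : 'I_m, Z 0%N x ord0 i <= 0}.
Hypothesis indep : forall k : nat, k.+1%:R * dt <= n%:R ->
  cond_pairwise_independent P (F k) alpha theta (fun x => Z k.+1 x - Z k x).
Hypothesis stepM : forall k : nat, k.+1%:R * dt <= n%:R ->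
  {ae P, forall x, `|Z k.+1 x - Z k x| <= M}.

Lemma card_ever_bad_tail :
  ((1 - 1 / n%:R ^+ q)%R%:E <=
   P [set x | (#|ever_bad n dt B Z x|%:R <=
        m%:R / expR (lambda * B)
        + 8 * q%:R * (lambda * alpha * ln n%:R / theta))%R])%E.
Proof.
set S := [set x | _].
have mZ k i : measurable_fun setT (fun x => Z k x ord0 i).
  exact: (wrt_measurable_fun (filtF.1 k) (adZ k i)).
have mS : measurable S by exact: measurable_card_ever_bad.
(* The last step within the time horizon. *)
pose N := Num.trunc (n%:R / dt).
have kN k : (k <= N)%N = (k%:R * dt <= n%:R).
  by rewrite -ler_pdivlMr// /N truncn_ge_nat// divr_ge0// ltW.
pose delta := rate lambda alpha theta B.
have d0 : 0 < delta by exact: rate_gt0.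
pose f x := expR (delta * potential lambda (frozen B M Z N x)).
(* The threshold exceeds the bound on the expectation of [f] by the factor [n ^ q], so Markov's
   inequality leaves [n ^ (- q)]. *)
pose K := expR (delta * m%:R) * n%:R ^+ q.
have nR : 0 < n%:R :> R by rewrite ltr0n.
have K0 : 0 < K by rewrite mulr_gt0 ?expR_gt0// exprn_gt0.
have mf : bounded_measurable f.
  exact: (bounded_measurable_expR_potential filtF adZ (ltW B0) M0 l0 N (ltW d0)).
have Ef : \int[P]_x f x <= expR (delta * m%:R).
  apply: (frozen_supermartingale filtF adZ (ltW B0) M0 l0 lt al lM tM mM).
    by move=> k; rewrite kN; exact: indep.
  by move=> k; rewrite kN; exact: stepM.
have PK : (P [set x | (K <= f x)%R] <= (1 / n%:R ^+ q)%:E)%E.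
  apply: le_trans (markov_bounded_measurable P K0 (fun x => expR_ge0 _) mf) _.
  rewrite lee_fin ler_pdivrMr// /K mulrCA div1r mulVf ?mulr1// expf_neq0//.
  by rewrite gt_eqF.
have mfK : measurable [set x | K <= f x].
  rewrite (_ : [set x | _] = f @^-1` `[K, +oo[).
    by rewrite -[X in measurable X]setTI; apply: mf.1 => //; exact: measurable_itv.
  by apply/seteqP; split=> x /=; rewrite in_itv/= andbT.
(* A single null event [A] collects all failures of the almost sure hypotheses on the initial values
   and step sizes. *)
have [A [mA PA goodA]] : {ae P, forall x, (forall i, Z 0%N x ord0 i <= 0) /\
    (forall k, (k < N)%N -> `|Z k.+1 x - Z k x| <= M)}.
  have : {ae P, forall x k, (k < N)%N -> `|Z k.+1 x - Z k x| <= M}.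
    apply: ae_foralln => k; have [kN'|kN'] := boolP (k < N)%N.
      by move: (kN'); rewrite kN => /stepM; apply: filterS => x h _.
    by apply: filterS Z0 => x _.
  by apply: filterS2 Z0 => x.
have SC : ~` S `<=` A `|` [set x | K <= f x].
  move=> x; rewrite /S/= => /negP; rewrite -ltNge => bad.
  have [xA|xA] := pselect (A x); [by left|right].
  have [Z0x stepx] : (forall i, Z 0%N x ord0 i <= 0) /\
    (forall k, (k < N)%N -> `|Z k.+1 x - Z k x| <= M).
    by apply: contrapT => h; apply: xA; exact: goodA.
  have E0 := expR_gt0 (lambda * B).
  have Phi : #|ever_bad n dt B Z x|%:R * expR (lambda * B) <=
      potential lambda (frozen B M Z N x).
    rewrite -sum1_card natr_sum mulr_suml big_mkcond/=; apply: ler_sum => i _.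
    case: ifPn => [|_]; last exact: expR_ge0.
    rewrite unfold_in /ever_bad/= => /asboolP[k [kn ZB]].
    rewrite mul1r ler_expR ler_pM2l//; apply: bad_frozen => //.
    by exists k => //; rewrite kN.
  have -> : K = expR (delta * m%:R + q%:R * ln n%:R).
    by rewrite expRD expRM_natl lnK ?posrE.
  rewrite /f ler_expR; apply: le_trans (_ : delta *
     (#|ever_bad n dt B Z x|%:R * expR (lambda * B)) <= _); last first.
    by rewrite ler_pM2l.
  (* Origin of the constant [8 * q]: dividing [q * ln n] by [delta * expR (lambda * B)] gives
     [8 * q * lambda * alpha * ln n / theta]. *)
  have -> : delta * m%:R + q%:R * ln n%:R = delta *
    ((m%:R / expR (lambda * B) + 8 * q%:R * (lambda * alpha * ln n%:R / theta))
     * expR (lambda * B)).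
    rewrite /delta /rate; field.
    have t0 : 0 < theta.
      by move: (lt_le_trans l0 lt); rewrite pmulr_lgt0 ?invr_gt0.
    by rewrite !gt_eqF// (lt_le_trans ltr01 al).
  by rewrite ler_pM2l// ler_pM2r// ltW.
have PSC : (P (~` S) <= (1 / n%:R ^+ q)%:E)%E.
  apply: le_trans (_ : P (A `|` [set x | (K <= f x)%R]) <= _)%E.
    apply: le_measure => //; rewrite inE; [exact: measurableC|exact: measurableU].
  apply: le_trans (measureU2 _ _ _) _ => //.
  by rewrite -[leRHS]add0e leeD// le_eqVlt; apply/orP; left; apply/eqP.
move: PSC; rewrite probability_setC// EFinB => h.
by rewrite leeBlDr// addeC -leeBlDr// ?fin_num_measure.
Qed.

End ManyBad.

(** * The step size and the final theorem *)

Lemma step_bound_small {R : realType} (K L : R) (a b : nat) (c : R) :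
  (2 * (a * b.+2).+1)%:R <= c ->
  exists n0 : nat, forall n : nat, (n0 <= n)%N ->
  forall S : R, 0 <= S -> S <= K * n%:R ^+ a ->
  S ^+ 2 * (L * S ^+ b * Num.sqrt (1 / n%:R `^ c)) <= 1 / 4.
Proof.
move=> hc; pose C := 4 * `|L| * `|K| ^+ b.+2.
exists (Num.trunc C).+1 => n nC S S0 SK.
have Cn : C <= n%:R.
  by apply/ltW/(lt_le_trans (truncnS_gt _)); rewrite ler_nat.
have n1 : 1 <= n%:R :> R by rewrite ler1n (leq_trans _ nC).
have npos : 0 < n%:R :> R by exact: lt_le_trans ltr01 n1.
(* The square root halves the exponent [c]. What remains beats the growth [n ^ (a * (b + 2))] of
   [S ^+ b.+2] by one factor [n], which absorbs the constant [C]. *)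
have sqrt_le : Num.sqrt (1 / n%:R `^ c) <= n%:R ^- (a * b.+2).+1.
  have r0 : 0 <= n%:R ^- (a * b.+2).+1 :> R by rewrite invr_ge0 exprn_ge0.
  rewrite -[leRHS](ger0_norm r0) -sqrtr_sqr ler_sqrt; last exact: sqr_ge0.
  rewrite div1r -exprVn -exprM exprVn mulnC lef_pV2 ?posrE ?exprn_gt0 ?powR_gt0//.
  by rewrite -powR_mulrn// ler_powR.
have Sb : S ^+ b.+2 <= (`|K| ^+ b.+2) * n%:R ^+ (a * b.+2).
  rewrite exprM -exprMn lerXn2r ?nnegrE ?mulr_ge0 ?exprn_ge0//.
  apply: le_trans SK _; rewrite ler_wpM2r ?exprn_ge0//; exact: ler_norm.
have -> : S ^+ 2 * (L * S ^+ b * Num.sqrt (1 / n%:R `^ c)) =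
    L * (S ^+ b.+2 * Num.sqrt (1 / n%:R `^ c)).
  by rewrite (_ : b.+2 = 2 + b)%N// exprD; ring.
apply: le_trans (_ : `|L| * (`|K| ^+ b.+2 / n%:R) <= _); last first.
  have -> : `|L| * (`|K| ^+ b.+2 / n%:R) = C / n%:R / 4.
    by rewrite /C; field; rewrite gt_eqF.
  by rewrite ler_pM2r ?invr_gt0// ler_pdivrMr// mul1r.
apply: le_trans (_ : `|L| * (S ^+ b.+2 * Num.sqrt (1 / n%:R `^ c)) <= _).
  by rewrite ler_wpM2r ?ler_norm// mulr_ge0 ?exprn_ge0// sqrtr_ge0.
rewrite ler_wpM2l//.
apply: le_trans (_ : (`|K| ^+ b.+2 * n%:R ^+ (a * b.+2)) *
    n%:R ^- (a * b.+2).+1 <= _).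
  by rewrite ler_pM ?exprn_ge0// sqrtr_ge0.
have u0 : 0 < n%:R ^+ (a * b.+2) :> R by exact: exprn_gt0.
move: u0; rewrite (exprS n%:R); set u := _ ^+ (a * b.+2) => u0.
by rewrite le_eqVlt; apply/orP; left; apply/eqP; field; rewrite !gt_eqF.
Qed.

Theorem theorem3p7 (R : realType) (q : nat) :
  exists C : R,
  forall (K : R) (a : nat) (L : R) (b : nat),
  exists c0 : R, forall c : R, c0 <= c ->
  exists n0 : nat, forall n : nat, (n0 <= n)%N ->
  forall (d : measure_display) (T : measurableType d) (P : probability T R)
    (m : nat) (alpha theta B dt : R)
    (F : nat -> set (set T)) (Z : nat -> T -> 'rV[R]_m),
  1 <= alpha -> 0 < theta -> 1 <= B ->
  m%:R <= K * n%:R ^+ a -> alpha <= K * n%:R ^+ a ->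
  theta <= K * n%:R ^+ a -> B <= K * n%:R ^+ a ->
  dt = 1 / n%:R `^ c ->
  filtration F ->
  (forall (k : nat) (i : 'I_m), wrt_measurable (F k) (fun x => Z k x ord0 i)) ->
  {ae P, forall x, forall i : 'I_m, Z 0%N x ord0 i <= 0} ->
  (forall k : nat, k.+1%:R * dt <= n%:R ->
     cond_pairwise_independent P (F k) alpha theta
       (fun x => Z k.+1 x - Z k x)) ->
  (forall k : nat, k.+1%:R * dt <= n%:R ->
     {ae P, forall x, `|Z k.+1 x - Z k x| <=
        L * (1 + m%:R + alpha + theta + B) ^+ b * Num.sqrt dt}) ->
  forall lambda : R, 0 < lambda -> lambda <= theta / 2 ->
    lambda * B <= ln n%:R ->
  ((1 - 1 / n%:R ^+ q)%R%:E <=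
   P [set x | (#|ever_bad n dt B Z x|%:R <=
        m%:R / expR (lambda * B) + C * (lambda * alpha * ln n%:R / theta))%R])%E.
Proof.
exists (8 * q%:R) => K a L b.
exists (2 * (a * b.+2).+1)%:R => c hc.
(* Each of the five summands of [S] is at most [K * n ^ a], the summand 1 because [1 <= alpha]. The
   absolute value of [L] ensures a nonnegative step bound [M]. *)
have [n0 small] := step_bound_small (5 * K) `|L| hc.
exists n0.+1 => n n0n d T P m alpha theta B dt F Z al t0 B1 mK aK tK BK dtE.
move=> filtF adZ Z0 indep stepM lambda l0 lt _.
set S := 1 + m%:R + alpha + theta + B in stepM.
have m0 : 0 <= m%:R :> R by [].
have S2 : 2 <= S by rewrite /S; lra.
have S0 : 0 <= S by lra.
have SK : S <= 5 * K * n%:R ^+ a by rewrite /S -mulrA; lra.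
have := small n (ltnW n0n) S S0 SK; rewrite -dtE.
set M := `|L| * S ^+ b * Num.sqrt dt => SM.
have M0 : 0 <= M by rewrite !mulr_ge0 ?exprn_ge0// sqrtr_ge0.
have lS : lambda <= S by rewrite /S; lra.
have tS : theta <= S by rewrite /S; lra.
have mS : m%:R <= S by rewrite /S; lra.
have S1 : 1 <= S by lra.
have SMM : S * M <= S ^+ 2 * M by rewrite ler_wpM2r// expr2 ler_peMr.
have lMS : lambda * M <= S * M by rewrite ler_wpM2r.
have lM0 : 0 <= lambda * M by rewrite mulr_ge0// ltW.
apply: (card_ever_bad_tail filtF adZ (M := M)) => //.
- by lra.
- by rewrite dtE divr_gt0// powR_gt0// ltr0n (leq_trans _ n0n).
- by rewrite (leq_trans _ n0n).
- by lra.
- apply: le_trans SM; rewrite ler_wpM2r// expr2 ler_pM//; exact: ltW.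
(* The cube of [S] times the square of [M] splits into [S ^+ 2 * M] and [S * M], both at most
   1/4. *)
- apply: le_trans (_ : S * (S * M) ^+ 2 <= _).
    by rewrite ler_pM ?sqr_ge0// lerXn2r ?nnegrE// mulr_ge0.
  have -> : S * (S * M) ^+ 2 = (S ^+ 2 * M) * (S * M) by ring.
  apply: le_trans (_ : 1 / 4 * (1 / 4) <= _); last by lra.
  apply: ler_pM => //; last exact: le_trans SMM SM.
    by apply: mulr_ge0 => //; exact: sqr_ge0.
  exact: mulr_ge0.
- move=> k kn; apply: filterS (stepM k kn) => x h; apply: le_trans h _.
  by rewrite ler_wpM2r ?sqrtr_ge0// ler_wpM2r ?exprn_ge0// ler_norm.
Qed.
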